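(* Let $\alpha:\mathbb{R}\to(0,\infty)$ be a continuous function with $0<\inf_{z\in\mathbb{R}}\alpha(z)\le\sup_{z\in\mathbb{R}}\alpha(z)<\infty$ and $\lim_{z\to\infty}\alpha(z)=1$. Let $(L_t)_{t\ge 0}$ be a real-valued Lévy process satisfying $\mathbf{E}[\exp(L_1)]=1$. Let $(X_t)_{t\ge0}$ be the time-changed process given by $X_t(x)=L_{T_x(t)}+x$ for $t\ge 0$, $x\in\mathbb{R}$, where $T_x(t)=\inf\{s\ge0 \mid \int_0^s\alpha(L_r+x)\,\mathrm{d}r>t\}$. Then the measure $\alpha(x)\exp(-x)\,\mathrm{d}x$ on $\mathbb{R}$ is invariant for $(X_t)_{t\ge0}$, that is, for all Borel sets $B\subset\mathbb{R}$ and all $t\ge0$, $$\int_{\mathbb{R}}\mathbf{P}[X_t(x)\in B]\,\alpha(x)\exp(-x)\,\mathrm{d}x=\int_B\alpha(x)\exp(-x)\,\mathrm{d}x.$$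
   Context: Lévy processes are real-valued, started at $L_0=0$, with càdlàg paths. For each $x$, the process $(X_t(x))_{t\ge0}$ is the time-changed process started in $x$ at time $0$. *)

(* Defs.v *)
From HB Require Import structures.
From mathcomp Require Import all_boot all_order all_algebra.
From mathcomp Require Import all_classical all_reals all_analysis.

Set Implicit Arguments.
Unset Strict Implicit.
Unset Printing Implicit Defensive.

Import Order.TTheory GRing.Theory Num.Theory.
Import numFieldNormedType.Exports.
Local Open Scope classical_set_scope.
Local Open Scope ring_scope.

Section Levy.
Context {d : measure_display} {T : measurableType d} {R : realType}.
Variable P : probability T R.

Definition mutually_independent {I : finType} (X : I -> T -> R) : Prop :=
  forall (J : {set I}) (B : I -> set R),
    (forall i, i \in J -> measurable (B i)) ->
    P (\bigcap_(i in [set` J]) X i @^-1` B i) =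
      (\prod_(i in J) P (X i @^-1` B i))%E.

Definition identically_distributed (X Y : T -> R) : Prop :=
  forall B : set R, measurable B -> P (X @^-1` B) = P (Y @^-1` B).

(* Processes indexed by time in [0, +oo[ are families indexed by R whose values
   at negative times are unconstrained and never used. *)
Definition cadlag (f : R -> R) : Prop :=
  (forall t, 0 <= t -> f s @[s --> t^'+] --> f t) /\
  (forall t, 0 < t -> cvg (f s @[s --> t^'-])).

(* In the second field, the increments are those between the times
   t 0 <= t 1 <= ... <= t n. *)
Record is_levy_process (L : R -> {RV P >-> R}) : Prop := IsLevyProcess {
  levy_start : forall w, L 0 w = 0 ;
  levy_independent_increments : forall (n : nat) (t : nat -> R),
    (forall i, 0 <= t i) -> nondecreasing_seq t ->
    mutually_independent (fun i : 'I_n => L (t i.+1) \- L (t i)) ;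
  levy_stationary_increments : forall s t : R, 0 <= s -> 0 <= t ->
    identically_distributed (L (s + t) \- L s) (L t) ;
  levy_cadlag : forall w, cadlag (fun t => L t w)
}.

Definition random_clock (alpha : R -> R) (L : R -> T -> R) (x t : R) (w : T) : R :=
  inf [set s : R | 0 <= s /\
    t < \int[lebesgue_measure]_(r in `[0, s]) alpha (L r w + x)].

Definition time_changed (alpha : R -> R) (L : R -> T -> R) (t x : R) (w : T) : R :=
  L (random_clock alpha L x t w) w + x.

End Levy.

(* Main.v *)
Require Import Defs.
From HB Require Import structures.
From mathcomp Require Import all_boot all_order all_algebra.
From mathcomp Require Import all_classical all_reals all_analysis measurable_realfun.
From mathcomp Require Import ring lra.
Set Implicit Arguments.
Unset Strict Implicit.
Unset Printing Implicit Defensive.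
Import Order.TTheory GRing.Theory Num.Theory.
Import numFieldNormedType.Exports.
Local Open Scope classical_set_scope.
Local Open Scope ring_scope.

(** Let Y_s = x + L_s, where x is spread over the line with the infinite
measure exp(-x) dx, independently of L.  Because E[exp(L_s)] = 1 for every
s >= 0, the flow Y is stationary: the distribution of the whole path
(Y_(s+r))_(r >= 0) is the same for every s.  Indeed, replacing x by x - L_s
produces the factor exp(L_s), which has mean 1 and is independent of the
increments of L after time s ([stationary]).

The theorem is the case at hand of a general fact: if a stationary flow is run
along the inverse of a clock A_s = int_0^s alpha(Y_r) dr, then the time-changed
flow preserves the original measure weighted by alpha(Y_0).  Here is the
argument.  Let I be the mass that the time-changed process gives to B at time
t, and J the integral of alpha(x) exp(-x) over B.  The process that starts
from Y_s and runs for t units of its own clock ends at Y_(tau(s)), where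
A_(tau(s)) = A_s + t.  By stationarity the outcome has the same distribution
for every s, so averaging over s in [0, S] gives
    S * I = E int exp(-x) (int_0^S alpha(Y_s) 1_B(Y_(tau(s))) ds) dx.
On each path, u = tau(s) satisfies alpha(Y_u) du = alpha(Y_s) ds, hence the
inner integral equals the integral of alpha(Y_u) 1_B(Y_u) over
[tau(0), tau(S)] ([density_tau]).  With C = t / inf alpha one has tau(0) <= C
and S <= tau(S) <= S + C, so that interval lies between [C, S] and [0, S + C].
Averaging again by stationarity yields
    (S - C) * J <= S * I <= (S + C) * J,
and I = J follows by letting S tend to infinity, even if J is infinite
([eq_of_asymptotic_bounds]).

Stationarity is a statement about whole paths, so it needs a sigma-algebra on
paths for which the time-changed position is measurable, and the equality of
the laws of the increments after time s and of L itself.  Both are obtained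
from dyadic times: a right-continuous path is determined by them, and on a
dyadic grid the increments of L are independent and identically distributed
([increment_path_law]). *)

(** * Measures and integrals *)

(** The pushforward as a bundled measure: the measurability of the map is an
explicit argument, so that the bundle can be formed for any map. *)
Definition image_measure d d' (T1 : measurableType d) (T2 : measurableType d')
  (R : realType) (m : {measure set T1 -> \bar R}) (f : T1 -> T2)
  (mf : measurable_fun setT f) : {measure set T2 -> \bar R}.
Proof. refine (pushforward m f : {measure set _ -> \bar R}). exact: mf. Defined.

(** A nonnegative integral is a supremum over the simple functions below the
integrand, so a pointwise comparison of the integrands suffices. *)
Lemma ge0_le_integral_pointwise d (R : realType) (T : measurableType d)
    (m : {measure set T -> \bar R}) (f g : T -> \bar R) :
  (forall x, (0 <= f x)%E) -> (forall x, (f x <= g x)%E) ->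
  (\int[m]_x f x <= \int[m]_x g x)%E.
Proof.
move=> f0 fg; rewrite !ge0_integralTE//; last by move=> x; apply: le_trans (fg x).
apply: ge_ereal_sup => _ [h hf <-]; apply: ereal_sup_ubound; exists h => // x.
exact: le_trans (fg x).
Qed.

Section deterministic_clock.
Variable R : realType.
Local Notation mu := (@lebesgue_measure R).

Lemma lebesgue_measure_shift (c : R) (A : set R) : measurable A ->
  pushforward mu (fun x : R => x + c : measurableTypeR R) A = mu A.
Proof.
move=> mA; apply/esym/lebesgue_measure_unique => //=.
  exact: measurable_funD.
move=> ? _ [[a b]] _ <-.
rewrite /pushforward/=.
have -> : (fun x : R => x + c) @^-1` `]a, b]%classic = `]a - c, b - c]%classic.
  by apply/seteqP; split=> x /=; rewrite !in_itv/= ltrBlDr lerBrDr.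
rewrite !lebesgue_measure_itv/= !lte_fin ltrD2r.
by case: ifP => //; rewrite -!EFinD opprB addrA subrK.
Qed.

Lemma lebesgue_measure_segment (u v : R) : u <= v -> mu `[u, v] = (v - u)%:E.
Proof.
move=> uv; rewrite lebesgue_measure_itv/= lte_fin; case: ltP => // vu.
by rewrite (_ : v = u) ?subrr//; apply/eqP; rewrite eq_le uv vu.
Qed.

Lemma integral_shift (c : R) (D : set R) (f : R -> \bar R) :
  measurable D -> measurable_fun setT f -> (forall x, (0 <= f x)%E) ->
  (\int[mu]_(x in D) f x = \int[mu]_(x in [set x | D (x + c)%R]) f (x + c)%R)%E.
Proof.
move=> mD mf f0.
pose s : measurableTypeR R -> measurableTypeR R := fun x => x + c.
have ms : measurable_fun setT s by exact: measurable_funD.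
transitivity (\int[pushforward mu s]_(x in D) f x)%E.
  by apply: eq_measure_integral => // A mA _; apply/esym/lebesgue_measure_shift.
rewrite (@ge0_integral_pushforward _ _ (measurableTypeR R) (measurableTypeR R) R _ ms mu D f)//.
exact: measurable_funS mf.
Qed.

Section density.
Variable f : R -> R.
Hypothesis mf : measurable_fun setT f.
Hypothesis f0 : forall x, 0 <= f x.

Definition density (E : set (measurableTypeR R)) : \bar R := (\int[mu]_(x in E) (f x)%:E)%E.

Let density0 : density set0 = 0%E.
Proof. by rewrite /density integral_set0. Qed.

Let density_ge0 E : (0 <= density E)%E.
Proof. by apply: integral_ge0 => x _; rewrite lee_fin. Qed.

Let density_sigma_additive : semi_sigma_additive density.
Proof.
move=> /= F mF tF mUF; rewrite /density; apply: cvg_toP.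
  apply: ereal_nondecreasing_is_cvgn => m n mn.
  by apply: lee_sum_nneg_natr => // k _ _; exact: density_ge0.
rewrite ge0_integral_bigcup//=.
- exact/measurable_funTS/measurableT_comp.
- by move=> x _; rewrite lee_fin.
Qed.

HB.instance Definition _ := isMeasure.Build _ _ _ density
  density0 density_ge0 density_sigma_additive.

(** A bundled version, which keeps the two hypotheses on [f] explicit. *)
Definition density_measure : {measure set (measurableTypeR R) -> \bar R}.
Proof. refine (density : {measure set (measurableTypeR R) -> \bar R}). Defined.

End density.

(** * The clock of a rate bounded away from zero and infinity *)

Section clock_of_rate.
Variables (h : R -> R) (a M : R).
Hypothesis mh : measurable_fun setT h.
Hypothesis a0 : 0 < a.
Hypothesis hb : forall x, a <= h x <= M.

Let h0 x : 0 <= h x. Proof. by have /andP[/(le_trans (ltW a0))] := hb x. Qed.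
Let M0 : 0 <= M. Proof. by have /andP[_] := hb 0; exact/le_trans/h0. Qed.

Definition primitive (s : R) : R := \int[mu]_(r in `[0, s]) h r.

Lemma integrable_rate (i : interval R) (u v : R) : [set` i] `<=` `[u, v]%classic ->
  mu.-integrable [set` i] (EFin \o h).
Proof.
move=> iuv; apply: (@integrableS _ _ _ mu _ _ (EFin \o h) _ _ iuv) => //.
apply: measurable_bounded_integrable => //.
- by rewrite /= lebesgue_measure_itv/=; case: ifPn => // _; rewrite -EFinB ltry.
- exact: measurable_funTS.
- exists M; split; rewrite ?num_real// => x Mx y _ /=.
  by rewrite ger0_norm// (le_trans _ (ltW Mx))//; case/andP: (hb y).
Qed.

Lemma density_itv b1 b2 (u v : R) : 0 <= u -> u <= v ->
  density h [set` Interval (BSide b1 u) (BSide b2 v)] = (primitive v - primitive u)%:E.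
Proof.
move=> u0 uv; have mhE := measurable_funTS (measurableT_comp (@EFin_measurable R setT) mh).
have -> : density h [set` Interval (BSide b1 u) (BSide b2 v)] =
    density h `]u, v]%classic.
  transitivity (density h [set` Interval (BSide b1 u) (BRight v)]).
    by case: b2 => //; exact: integral_itv_bndo_bndc.
  by case: b1 => //; apply/esym/integral_itv_obnd_cbnd.
rewrite /primitive (@Rintegral_itvB _ h (BLeft 0) (BRight v) u) ?bnd_simp//; last first.
  exact: (@integrable_rate _ 0 v).
rewrite /Rintegral fineK//; apply: integrable_fin_num => //.
by apply: (@integrable_rate _ u v); apply: subset_itvr; rewrite bnd_simp.
Qed.

(** The primitive is bi-Lipschitz.  This single estimate gives its strict
monotonicity, its continuity and the bounds on the clock. *)
Lemma primitive_bounds (u v : R) : 0 <= u -> u <= v ->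
  a * (v - u) <= primitive v - primitive u <= M * (v - u).
Proof.
move=> u0 uv; rewrite -!lee_fin -(density_itv true false u0 uv) /density.
have E (k : R) : (\int[mu]_(x in `[u, v]) (k%:E))%E = (k * (v - u))%:E.
  by rewrite integral_cst//= lebesgue_measure_segment.
have mhD : measurable_fun `[u, v]%classic (fun x => (h x)%:E).
  by apply: measurable_funTS; exact: measurableT_comp.
rewrite -!E; apply/andP; split; apply: ge0_le_integral => //=.
- by move=> x _; rewrite lee_fin ltW.
- by move=> x _; rewrite lee_fin; case/andP: (hb x).
- by move=> x _; rewrite lee_fin.
- by move=> x _; rewrite lee_fin; case/andP: (hb x).
Qed.

Lemma primitive0 : primitive 0 = 0.
Proof. by rewrite /primitive set_itv1 Rintegral_set1. Qed.

Lemma primitive_le (u v : R) : 0 <= u -> u <= v -> primitive u <= primitive v.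
Proof.
move=> u0 uv; have /andP[H _] := primitive_bounds u0 uv.
by rewrite -subr_ge0; apply: le_trans H; rewrite mulr_ge0 ?subr_ge0// ltW.
Qed.

Lemma primitive_lt (u v : R) : 0 <= u -> u < v -> primitive u < primitive v.
Proof.
move=> u0 uv; have /andP[H _] := primitive_bounds u0 (ltW uv).
by rewrite -subr_gt0; apply: lt_le_trans H; rewrite mulr_gt0 ?subr_gt0.
Qed.

Lemma primitive_leE (u v : R) : 0 <= u -> 0 <= v -> (primitive u <= primitive v) = (u <= v).
Proof.
move=> u0 v0; apply/idP/idP; last exact: primitive_le.
by apply: contraTT; rewrite -!ltNge; exact: primitive_lt.
Qed.

Lemma primitive_ltE (u v : R) : 0 <= u -> 0 <= v -> (primitive u < primitive v) = (u < v).
Proof. by move=> u0 v0; rewrite !ltNge primitive_leE. Qed.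

Definition clock (t : R) := inf [set s : R | 0 <= s /\ t < primitive s].

Lemma clock_has_inf t : 0 <= t -> has_inf [set s : R | 0 <= s /\ t < primitive s].
Proof.
move=> t0; split; last by exists 0 => x [].
exists ((t + 1) / a) => /=; have q0 : 0 <= (t + 1) / a by rewrite divr_ge0 ?addr_ge0// ltW.
split=> //; have /andP[+ _] := primitive_bounds (lexx 0) q0.
rewrite primitive0 !subr0 mulrC divfK ?gt_eqF//; apply: lt_le_trans.
by rewrite ltrDl.
Qed.

Lemma clock_ge0 t : 0 <= t -> 0 <= clock t.
Proof.
by move=> t0; apply: lb_le_inf; [case: (clock_has_inf t0)|move=> x []].
Qed.

(** The primitive has slope at most [M], so if its value at the infimum differed
from [t], then moving the infimum by the difference divided by [M + 1] would not
cross the level [t], which contradicts the definition of the infimum. *)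
Lemma primitive_clock t : 0 <= t -> primitive (clock t) = t.
Proof.
move=> t0; have M1 : 0 < M + 1 by rewrite ltr_wpDl.
have c0 := clock_ge0 t0; have hi := clock_has_inf t0.
apply/eqP; rewrite eq_le; apply/andP; split.
- rewrite leNgt; apply/negP => tc.
  pose e := (primitive (clock t) - t) / (M + 1).
  have e0 : 0 < e by rewrite divr_gt0// subr_gt0.
  have eE : e * (M + 1) = primitive (clock t) - t by rewrite /e divfK ?gt_eqF.
  have [ce|ce] := ltP (clock t) e.
    have /andP[_] := primitive_bounds (lexx 0) c0; rewrite primitive0 !subr0 => H.
    have : primitive (clock t) <= M * e by rewrite (le_trans H)// ler_wpM2l// ltW.
    nra.
  have ce0 : 0 <= clock t - e by rewrite subr_ge0.
  have ce1 : clock t - e <= clock t by rewrite gerBl ltW.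
  have H : t < primitive (clock t - e).
    have /andP[_] := primitive_bounds ce0 ce1.
    nra.
  have : clock t <= clock t - e by apply: ge_inf => //; case: hi.
  by rewrite lerBrDr gerDl leNgt e0.
- rewrite leNgt; apply/negP => tc.
  pose e := (t - primitive (clock t)) / (M + 1).
  have e0 : 0 < e by rewrite divr_gt0// subr_gt0.
  have eE : e * (M + 1) = t - primitive (clock t) by rewrite /e divfK ?gt_eqF.
  have : clock t + e <= clock t.
    apply: lb_le_inf; first by case: hi.
    move=> s [s0 ts]; rewrite leNgt; apply/negP => sce.
    have ce1 : clock t <= clock t + e by rewrite lerDl ltW.
    have /andP[_] := primitive_bounds c0 ce1.
    have := primitive_le s0 (ltW sce).
    nra.
  by rewrite gerDl leNgt e0.
Qed.

(** In this section [tau s] is the time at which the primitive has grown by [t]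
since time [s]. *)
Section change_of_variable.
Variables (t : R) (tau : R -> R).
Hypothesis t0 : 0 <= t.
Hypothesis tau0 : forall s, 0 <= s -> 0 <= tau s.
Hypothesis tauE : forall s, 0 <= s -> primitive (tau s) = primitive s + t.

Lemma tau_le (r s : R) : 0 <= r -> r <= s -> tau r <= tau s.
Proof.
move=> r0 rs; have s0 := le_trans r0 rs.
by rewrite -primitive_leE ?tau0// !tauE// lerD2r primitive_le.
Qed.

Lemma tau_ge (s : R) : 0 <= s -> s <= tau s.
Proof. by move=> s0; rewrite -primitive_leE ?tau0// tauE// lerDl. Qed.

Lemma tau_bound (s : R) : 0 <= s -> tau s <= s + t / a.
Proof.
move=> s0; have /andP[+ _] := primitive_bounds s0 (tau_ge s0).
by rewrite tauE// addrAC subrr add0r mulrC -ler_pdivlMr// lerBlDl.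
Qed.

(** The substitution [u = tau s]: the map [tau] carries the measure [h s ds] on
[[0, S]] to the measure [h u du] on [[tau 0, tau S]].  Since [h] is only
measurable, no differentiation is used.  Both sides are finite measures in [E],
and on a half-line [E] both can be read off from the primitive, which [tau]
increases by the constant [t]. *)
Lemma density_tau (S : R) (E : set R) : 0 <= S -> measurable E ->
  density h (`[0, S] `&` tau @^-1` E) = density h (`[tau 0, tau S] `&` E).
Proof.
move=> S0 mE.
(* [tau] is only controlled on nonnegative times; freezing it before time 0 makes
   it nondecreasing, hence measurable, on the whole line *)
pose tau' : measurableTypeR R -> measurableTypeR R :=
  fun s => tau (Num.max 0 s).
have mtau' : measurable_fun setT tau'.
  apply: nondecreasing_measurable => // r s rs.
  by apply: tau_le; [rewrite le_max lexx|rewrite ge_max !le_max lexx/= rs orbT].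
have tau'E s : 0 <= s -> tau' s = tau s by move=> s0; rewrite /tau' max_r.
have m0S : measurable (`[0, S]%classic : set (measurableTypeR R)) by exact: measurable_itv.
have mtS : measurable (`[tau 0, tau S]%classic : set (measurableTypeR R)) by exact: measurable_itv.
pose m := density_measure mh h0.
pose nu := image_measure (mrestr m m0S) mtau'.
pose ka := mrestr m mtS : {measure set (measurableTypeR R) -> \bar R}.
have nuE X : nu X = density h (tau' @^-1` X `&` `[0, S]) by [].
have kaE X : ka X = density h (X `&` `[tau 0, tau S]) by [].
suff: nu E = ka E.
  rewrite nuE kaE (setIC E) => <-; congr (density h _).
  apply/seteqP; split=> s /=; rewrite in_itv/= => -[].
    by move=> /andP[s0 sS]; rewrite tau'E// s0 sS.
  by move=> + /andP[s0 sS]; rewrite tau'E// s0 sS.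
apply: (@measure_unique _ R (measurableTypeR R) (@RGenInftyO.G R)
  (fun n => `]-oo, n%:R[%classic) _ _ _ _ nu ka) => //.
- exact: RGenInftyO.measurableE.
- move=> _ _ [x ->] [y ->]; exists (Num.min x y).
  by apply/seteqP; split=> z /=; rewrite !in_itv/= lt_min; [move=> [-> ->]|move=> /andP[]].
- by move=> n; exists n%:R.
- apply/seteqP; split=> // x _; exists (Num.truncn x).+1 => //=.
  by rewrite in_itv/= truncnS_gt.
- move=> _ [x ->]; rewrite nuE kaE.
  have t00 := tau0 (lexx 0); have tS0 := tau0 S0.
  have [xt0|t0x] := leP x (tau 0).
    rewrite (_ : _ `&` _ = set0) ?[X in _ = density _ X](_ : _ = set0)//.
      apply/seteqP; split=> // z /=; rewrite !in_itv/= => -[zx /andP[tz _]].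
      by have := lt_le_trans zx (le_trans xt0 tz); rewrite ltxx.
    apply/seteqP; split=> // z /=; rewrite !in_itv/= => -[zx /andP[z0 _]].
    rewrite tau'E// in zx.
    by have := lt_le_trans zx (le_trans xt0 (tau_le (lexx 0) z0)); rewrite ltxx.
  have [xtS|tSx] := leP x (tau S).
    have x0 : 0 <= x by rewrite (le_trans t00)// ltW.
    have xt : 0 <= primitive x - t.
      by rewrite subr_ge0 -[t]add0r -primitive0 -tauE//; apply: primitive_le => //; exact: ltW.
    (* [c] is the time that [tau] sends to [x] *)
    have c0 := clock_ge0 xt; have cE := primitive_clock xt.
    set c := clock _ in c0 cE.
    have cS : c <= S by rewrite -primitive_leE// cE lerBlDr -tauE// primitive_le.
    rewrite (_ : _ `&` _ = `[0, c[%classic).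
      rewrite [X in _ = density _ X](_ : _ = `[tau 0, x[%classic).
        by rewrite !density_itv// ?(ltW t0x)// cE tauE// primitive0 add0r subr0.
      apply/seteqP; split=> z /=; rewrite !in_itv/=.
        by move=> [zx /andP[-> _]].
      by move=> /andP[-> zx]; split=> //=; rewrite (le_trans (ltW zx)).
    apply/seteqP; split=> z /=; rewrite !in_itv/=.
      move=> [+ /andP[z0 zS]]; rewrite tau'E// -primitive_ltE ?tau0// tauE//.
      by rewrite -ltrBrDr -cE primitive_ltE// z0.
    move=> /andP[z0 zc]; rewrite z0 (le_trans (ltW zc) cS); split=> //.
    by rewrite tau'E// -primitive_ltE ?tau0// tauE// -ltrBrDr -cE primitive_ltE.
  rewrite (_ : _ `&` _ = `[0, S]%classic).
    rewrite [X in _ = density _ X](_ : _ = `[tau 0, tau S]%classic).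
      by rewrite !density_itv ?tau_le// !tauE// primitive0 add0r subr0 addrK.
    apply/seteqP; split=> z /=; rewrite !in_itv/=; first by move=> [].
    by move=> /andP[-> zS]; split=> //; rewrite (le_lt_trans zS).
  apply/seteqP; split=> z /=; rewrite !in_itv/=; first by move=> [].
  move=> /andP[z0 zS]; rewrite z0 zS tau'E//; split=> //.
  by rewrite (le_lt_trans _ tSx)// tau_le.
- move=> k; rewrite nuE; apply: (@le_lt_trans _ _ (density h `[0, S])).
    apply: (le_measure m); rewrite ?inE//.
    by apply: measurableI => //; rewrite -[X in measurable X]setTI; apply: (mtau' measurableT).
  by rewrite density_itv// ltry.
Qed.

(** The estimates [tau 0 <= t / a] and [S <= tau S <= S + t / a] squeeze the
occupation of [E] between two quantities that do not involve [tau]. *)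
Lemma density_tau_bounds (S : R) (E : set R) : 0 <= S -> measurable E ->
  (density h (`[(t / a)%R, S] `&` E) <= density h (`[0%R, S] `&` tau @^-1` E)
     <= density h (`[0%R, (S + t / a)%R] `&` E))%E.
Proof.
move=> S0 mE; rewrite density_tau//.
pose m := density_measure mh h0.
have mI u v : measurable (`[u, v]%classic `&` E : set (measurableTypeR R)).
  by apply: measurableI => //; exact: measurable_itv.
apply/andP; split; apply: (le_measure m); rewrite ?inE//; apply: setSI;
  apply: subset_itvScc; rewrite bnd_simp.
- by rewrite -[leRHS]add0r tau_bound.
- exact: tau_ge.
- exact: tau0.
- exact: tau_bound.
Qed.
End change_of_variable.

End clock_of_rate.

Lemma primitive_shift (h : R -> R) (a M s u : R) : measurable_fun setT h -> 0 < a ->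
  (forall x, a <= h x <= M) -> 0 <= s -> 0 <= u ->
  primitive (fun r => h (s + r)) u = primitive h (s + u) - primitive h s.
Proof.
move=> mh a0 hb s0 u0; apply: EFin_inj.
have h0 x : 0 <= h x by have /andP[/(le_trans (ltW a0))] := hb x.
have su : s <= s + u by rewrite lerDl.
have mhs : measurable_fun setT (fun r => h (s + r)).
  by apply: measurableT_comp => //; exact: measurable_funD.
rewrite -(density_itv mh a0 hb true false s0 su).
rewrite -[X in X%:E]subr0 -(primitive0 (fun r => h (s + r))).
rewrite -(density_itv mhs a0 (fun x => hb (s + x)) true false (lexx 0) u0).
have mhE : measurable_fun setT (fun x => (h x)%:E) by exact/measurable_EFinP.
rewrite /density [RHS](integral_shift s)//.
under [RHS]eq_integral do rewrite addrC.
by congr integral; apply/seteqP; split=> x /=; rewrite !in_itv/= lerDr [s + u]addrC lerD2r.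
Qed.

(** The time reached when the flow is restarted at time [s] and then runs for [t]
units of its clock.  It satisfies the two conditions imposed on [tau] above. *)
Definition shifted_clock (h : R -> R) (t s : R) := s + clock (fun r => h (s + r)) t.

Section shifted_clock.
Variables (h : R -> R) (a M t : R).
Hypothesis mh : measurable_fun setT h.
Hypothesis a0 : 0 < a.
Hypothesis hb : forall x, a <= h x <= M.
Hypothesis t0 : 0 <= t.

Let mhs (s : R) : measurable_fun setT (fun r : R => h (s + r)).
Proof. by apply: measurableT_comp => //; exact: measurable_funD. Qed.

Lemma shifted_clock_ge0 s : 0 <= s -> 0 <= shifted_clock h t s.
Proof.
move=> s0; rewrite addr_ge0//.
exact: (clock_ge0 (mhs s) a0 (fun x => hb (s + x))).
Qed.

Lemma primitive_shifted_clock s : 0 <= s ->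
  primitive h (shifted_clock h t s) = primitive h s + t.
Proof.
move=> s0; have c0 := clock_ge0 (mhs s) a0 (fun x => hb (s + x)) t0.
have := primitive_clock (mhs s) a0 (fun x => hb (s + x)) t0.
by rewrite (primitive_shift mh a0 hb)// => /eqP; rewrite subr_eq [t + _]addrC => /eqP.
Qed.

End shifted_clock.

Lemma clock_eq (h g : R -> R) t : (forall r, 0 <= r -> h r = g r) ->
  clock h t = clock g t.
Proof.
move=> hg; rewrite /clock; congr inf; apply/seteqP.
have E s : primitive h s = primitive g s.
  by apply: eq_Rintegral => r; rewrite inE/= in_itv/= => /andP[r0 _]; exact: hg.
by split=> s /= [s0]; rewrite E.
Qed.

Lemma density_indic (h : R -> R) (D F : set R) : measurable D -> measurable F ->
  (\int[mu]_(s in D) (h s * \1_F s)%:E)%E = density h (D `&` F).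
Proof.
move=> mD mF; rewrite /density integral_mkcondr; apply: eq_integral => s _.
by rewrite patchE indicE; case: ifPn => sF; rewrite ?mulr1 ?mulr0.
Qed.

(** The clock is below [b] exactly when the primitive exceeds [t] at the fixed
time [b], and the primitive at a fixed time is a measurable function of the
parameter by Tonelli's theorem. *)
Lemma measurable_clock d (Z : measurableType d) (h : Z * R -> R) (a M t : R) :
  measurable_fun setT h -> 0 < a -> (forall z, a <= h z <= M) -> 0 <= t ->
  measurable_fun setT (fun z => clock (fun r => h (z, r)) t).
Proof.
move=> mh a0 hb t0.
have mhz z : measurable_fun setT (fun r : R => h (z, r)).
  by apply: measurableT_comp => //; exact: pair1_measurable.
have cl0 z : 0 <= clock (fun r => h (z, r)) t.
  exact: (clock_ge0 (mhz z) a0 (fun r => hb (z, r)) t0).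
apply: (measurability (@RGenInftyO.G R)) => [|_ [_ [b ->] <-]].
  exact: RGenInftyO.measurableE.
rewrite setTI; have [b0|b0] := leP b 0.
  rewrite (_ : _ @^-1` _ = set0)//; apply/seteqP; split=> // z /=.
  by rewrite in_itv/= ltNge (le_trans b0).
rewrite (_ : _ @^-1` _ = (fun z => primitive (fun r => h (z, r)) b) @^-1` `]t, +oo[).
  rewrite -[X in measurable X]setTI.
  suff: measurable_fun setT (fun z => primitive (fun r => h (z, r)) b) by apply.
  apply: measurableT_comp; first exact: fine_measurable.
  rewrite (_ : (fun z => _) = fun z =>
      (\int[mu]_r ((fun zr : Z * R => (h zr * \1_(`[0%R, b]%classic : set R) zr.2)%:E) (z, r)))%E).
    have mi : measurable_fun setT (\1_(`[0, b]%classic : set R) : R -> R).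
      by apply: measurable_indic; exact: measurable_itv.
    have mhi : measurable_fun setT
        (fun zr : Z * R => (h zr * \1_(`[0%R, b]%classic : set R) zr.2)%:E).
      apply/measurable_EFinP; apply: measurable_funM => //.
      exact: (measurableT_comp mi measurable_snd).
    apply: (@measurable_fun_fubini_tonelli_F _ _ Z (measurableTypeR R) R mu _ mhi).
    by move=> zr; rewrite lee_fin mulr_ge0//; have /andP[/(le_trans (ltW a0))] := hb zr.
  apply/funext => z; rewrite -[LHS]/(density _ _) -[`[0, b]%classic]setTI -density_indic//.
  by rewrite setTI.
apply/seteqP; split=> z /=; rewrite !in_itv/= andbT.
  rewrite -(primitive_ltE (mhz z) a0 (fun r => hb (z, r)) (cl0 z) (ltW b0)).
  by rewrite (primitive_clock (mhz z) a0 (fun r => hb (z, r)) t0).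
move=> H; rewrite -(primitive_ltE (mhz z) a0 (fun r => hb (z, r)) (cl0 z) (ltW b0)).
by rewrite (primitive_clock (mhz z) a0 (fun r => hb (z, r)) t0).
Qed.

Lemma measurable_shifted_clock (h : R -> R) (a M t : R) :
  measurable_fun setT h -> 0 < a -> (forall z, a <= h z <= M) -> 0 <= t ->
  measurable_fun setT (shifted_clock h t).
Proof.
move=> mh a0 hb t0; apply: measurable_funD => //.
apply: (@measurable_clock _ R (fun zr => h (zr.1 + zr.2)) a M) => //.
by apply: measurableT_comp => //; apply: measurable_funD.
Qed.

End deterministic_clock.

(** * A sigma-algebra on paths generated by dyadic times *)

Section paths.
Variable R : realType.

(** All sides are recorded, almost all of them being full, so that the
intersection of two rectangles is taken side by side. *)
Definition finite_rectangles : set (set (nat -> R)) :=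
  [set A | exists B : nat -> set R, exists n : nat, [/\ forall i, measurable (B i),
    forall i, (n <= i)%N -> B i = setT & A = [set a | forall i, B i (a i)]]].

Definition seq_space := g_sigma_algebraType finite_rectangles.

Definition dyadic (m k : nat) : R := k%:R / 2 ^+ m.

(** The [m]-th grid contributes a whole sigma-algebra and not only rectangles of
values: the independent quantities are the increments along the grid, and the
values are their partial sums, so rectangles of values do not correspond to
rectangles of increments. *)
Definition dyadic_cylinders : set (set (R -> R)) :=
  [set A | exists m : nat, exists S : set seq_space,
     measurable S /\ A = [set p | S (fun k => p (dyadic m k))]].

Definition path_space := g_sigma_algebraType dyadic_cylinders.

Lemma measurable_seq_spaceP d (T : measurableType d) (f : T -> seq_space) :
  (forall i, measurable_fun setT (fun w => f w i)) -> measurable_fun setT f.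
Proof.
move=> mf; apply: (@measurability _ _ T seq_space setT f finite_rectangles) =>
  // _ [_ [B [n [mB _ ->]] <-]].
rewrite setTI (_ : _ @^-1` _ = \bigcap_i ((fun w => f w i) @^-1` B i)).
  by apply: bigcapT_measurable => i; rewrite -[X in measurable X]setTI; exact: mf.
by apply/seteqP; split=> w /= H; [move=> i _; exact: H|move=> i; exact: (H i I)].
Qed.

Lemma measurable_seq_nth i : measurable_fun [set: seq_space] (fun a => a i).
Proof.
move=> _ Y mY; rewrite setTI; apply: sub_sigma_algebra.
exists (fun j => if j == i then Y else setT), i.+1; split.
- by move=> j; case: ifP.
- by move=> j; case: eqP => // -> ; rewrite ltnn.
- apply/seteqP; split=> a /=; first by move=> aY j; case: eqP => // ->.
  by move/(_ i); rewrite eqxx.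
Qed.

Lemma measurable_path_spaceP d (T : measurableType d) (f : T -> path_space) :
  (forall m k, measurable_fun setT (fun w => f w (dyadic m k))) ->
  measurable_fun setT f.
Proof.
move=> mf; apply: (@measurability _ _ T path_space setT f dyadic_cylinders) =>
  // _ [_ [m [S [mS ->]] <-]].
have := @measurable_seq_spaceP _ _ (fun w => (fun k => f w (dyadic m k)) : seq_space) (mf m).
exact.
Qed.

Lemma measurable_path_dyadic m k : measurable_fun [set: path_space] (fun p => p (dyadic m k)).
Proof.
move=> _ Y mY; rewrite setTI; apply: sub_sigma_algebra.
exists m, [set a | Y (a k)]; split => //.
by rewrite -[X in measurable X]setTI; exact: (measurable_seq_nth k).
Qed.

Lemma seq_measure_unique (m1 m2 : {measure set seq_space -> \bar R}) :
  (m1 setT < +oo)%E -> (forall A, finite_rectangles A -> m1 A = m2 A) ->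
  forall A, measurable A -> m1 A = m2 A.
Proof.
move=> fin12 m12; apply: (@measure_unique _ R seq_space finite_rectangles (fun=> setT)
  erefl _ _ _ m1 m2) => //.
- move=> _ _ [B [n [mB nB ->]]] [C [k [mC kC ->]]].
  exists (fun i => B i `&` C i), (maxn n k); split.
  + by move=> i; exact: measurableI.
  + by move=> i; rewrite geq_max => /andP[ni ki]; rewrite nB// kC// setIT.
  + apply/seteqP; split=> a /=; first by move=> [aB aC] i; split.
    by move=> H; split=> i; have [] := H i.
- by move=> _; exists (fun=> setT), 0%N; split=> //; apply/seteqP; split.
- by apply/seteqP; split=> // x _; exists 0%N.
Qed.

Lemma dyadicM m n k : dyadic (m + n)%N (k * 2 ^ n)%N = dyadic m k.
Proof.
by rewrite /dyadic natrM natrX exprD invfM mulrACA divff ?mulr1 ?expf_neq0 ?pnatr_eq0.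
Qed.

(** Cylinders over two grids are both cylinders over a common refinement, so the
dyadic cylinders are stable under intersection. *)
Lemma path_measure_unique (m1 m2 : {measure set path_space -> \bar R}) :
  (m1 setT < +oo)%E -> (forall A, dyadic_cylinders A -> m1 A = m2 A) ->
  forall A, measurable A -> m1 A = m2 A.
Proof.
move=> fin12 m12; apply: (@measure_unique _ R path_space dyadic_cylinders (fun=> setT)
  erefl _ _ _ m1 m2) => //.
- move=> _ _ [m [S [mS ->]]] [n [U [mU ->]]].
  pose f j (a : seq_space) : seq_space := fun k => a (k * 2 ^ j)%N.
  have mf j : measurable_fun setT (f j).
    by apply: measurable_seq_spaceP => i; exact: measurable_seq_nth.
  exists (m + n)%N, (f n @^-1` S `&` f m @^-1` U); split.
    by apply: measurableI; rewrite -[X in measurable X]setTI; exact: mf.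
  have fE1 (p : R -> R) : f n (fun k => p (dyadic (m + n) k)) = (fun k => p (dyadic m k)).
    by apply/funext => k; rewrite /f dyadicM.
  have fE2 (p : R -> R) : f m (fun k => p (dyadic (m + n) k)) = (fun k => p (dyadic n k)).
    by apply/funext => k; rewrite /f addnC dyadicM.
  by apply/seteqP; split=> p /=; rewrite fE1 fE2.
- by move=> _; exists 0%N, setT; split.
- by apply/seteqP; split=> // x _; exists 0%N.
Qed.

(** The value at time [s], read from the dyadic times that decrease to [s].  The
limit superior makes this a measurable function of [s] and of an arbitrary
path; [fine] returns a junk value when it is infinite, which never happens for
right-continuous paths. *)
Definition path_value (s : R) (p : path_space) : R :=
  fine (limn_esup (fun m => (p (dyadic m (Num.truncn (2 ^+ m * s)).+1))%:E)).

Lemma measurable_truncn_eq (c : R) k :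
  measurable [set s : R | Num.truncn (c * s) = k].
Proof.
have mt : measurable_fun setT (fun s : R => (Num.truncn s)%:R : R).
  by apply: nondecreasing_measurable => // r s rs; rewrite ler_nat le_truncn.
have mc : measurable_fun setT (fun s : R => (Num.truncn (c * s))%:R : R).
  by apply: (measurableT_comp mt); exact: mulrl_measurable.
have := mc measurableT [set k%:R] (measurable_set1 _); rewrite setTI.
by congr measurable; apply/seteqP; split=> s /=; [move/eqP; rewrite eqr_nat => /eqP|move=> ->].
Qed.

(** The dyadic time just after [s] takes countably many values, each on an
interval of times [s]. *)
Lemma measurable_path_value_uncurried :
  measurable_fun setT (fun sp : R * path_space => path_value sp.1 sp.2).
Proof.
apply: measurableT_comp; first exact: fine_measurable.
apply: measurable_fun_limn_esup => m; apply/measurable_EFinP.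
move=> _ Y mY; rewrite setTI.
rewrite (_ : _ @^-1` _ = \bigcup_k ([set s : R | Num.truncn (2 ^+ m * s) = k] `*`
   (fun p : path_space => p (dyadic m k.+1)) @^-1` Y)).
  apply: bigcupT_measurable => k; apply: measurableX; first exact: measurable_truncn_eq.
  by rewrite -[X in measurable X]setTI; exact: measurable_path_dyadic.
apply/seteqP; split=> -[s p] /=; last by move=> [k _ [/= <-]].
by move=> H; exists (Num.truncn (2 ^+ m * s)).
Qed.

Lemma measurable_path_value d (Z : measurableType d) (f : Z -> R) (g : Z -> path_space) :
  measurable_fun setT f -> measurable_fun setT g ->
  measurable_fun setT (fun z => path_value (f z) (g z)).
Proof.
move=> mf mg; apply: (measurableT_comp measurable_path_value_uncurried (g := fun z => (f z, g z))).
exact: measurable_fun_pair.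
Qed.

Lemma dyadic_above_cvg (s : R) (p : R -> R) : 0 <= s -> p r @[r --> s^'+] --> p s ->
  p (dyadic m (Num.truncn (2 ^+ m * s)).+1) @[m --> \oo] --> p s.
Proof.
move=> s0 ps.
have Hgt m : s < dyadic m (Num.truncn (2 ^+ m * s)).+1.
  by rewrite /dyadic ltr_pdivlMr ?exprn_gt0// mulrC truncnS_gt.
have Hle m : dyadic m (Num.truncn (2 ^+ m * s)).+1 <= s + 2^-1 ^+ m.
  rewrite /dyadic -natr1 mulrDl exprVn mul1r lerD2r ler_pdivrMr ?exprn_gt0// mulrC.
  by rewrite truncn_le// mulr_ge0// exprn_ge0.
move/cvg_at_rightP : ps; apply; split => //.
apply: (@squeeze_cvgr _ _ _ _ (cst s) (fun n => s + 2^-1 ^+ n)).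
- by near=> n; rewrite Hle ltW.
- exact: cvg_cst.
- rewrite -[X in _ --> X]addr0; apply: cvgD; first exact: cvg_cst.
  by apply: cvg_expr; rewrite ger0_norm ?invr_ge0// invf_lt1// ltr1n.
Unshelve. all: by end_near. Qed.

Lemma path_value_right_cvg (s : R) (p : R -> R) :
  0 <= s -> p r @[r --> s^'+] --> p s -> path_value s p = p s.
Proof.
move=> s0 ps; rewrite /path_value.
have H : (p (dyadic m (Num.truncn (2 ^+ m * s)).+1))%:E @[m --> \oo] --> (p s)%:E.
  by apply: cvg_EFin; [exact: nearW|exact: dyadic_above_cvg].
by rewrite is_cvg_limn_esupE; [rewrite (cvg_lim _ H)|apply/cvg_ex; exists (p s)%:E].
Qed.

End paths.

(** * The increments of a Levy process after a fixed time *)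

Section levy_increments.
Context {R : realType} {d : measure_display} {T : measurableType d}.
Variables (P : probability T R) (L : R -> {RV P >-> R}).
Hypothesis hL : is_levy_process L.
Local Notation path_space := (path_space R).
Local Notation seq_space := (seq_space R).
Local Notation dyadic := (@dyadic R).

Definition increment_path (s : R) (w : T) : path_space := fun r => L (s + r) w - L s w.

Lemma measurable_increment_path s : measurable_fun setT (increment_path s).
Proof.
by apply: measurable_path_spaceP => m k; apply: measurable_funB;
  exact: measurable_funPT.
Qed.

Lemma path_value_increment_path s r w : 0 <= s -> 0 <= r ->
  path_value r (increment_path s w) = L (s + r) w - L s w.
Proof.
move=> s0 r0; rewrite path_value_right_cvg//.
have [rc _] := levy_cadlag hL w; have sr := rc _ (addr_ge0 s0 r0).
rewrite /increment_path; apply: cvgB; last exact: cvg_cst.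
apply/cvg_at_rightP => u [ru ur].
move/cvg_at_rightP : sr; apply; split; first by move=> n; rewrite ltrD2l.
by apply: cvgD => //; exact: cvg_cst.
Qed.

Lemma path_value_increment_path0 r w : 0 <= r -> path_value r (increment_path 0 w) = L r w.
Proof. by move=> r0; rewrite path_value_increment_path// add0r levy_start// subr0. Qed.

Lemma dyadic0 m : dyadic m 0 = 0. Proof. by rewrite /dyadic mul0r. Qed.

Lemma dyadicS m k : dyadic m k.+1 = dyadic m k + dyadic m 1.
Proof. by rewrite /dyadic -mulrDl natr1. Qed.

Lemma dyadic_ge0 m k : 0 <= dyadic m k.
Proof. by rewrite divr_ge0// exprn_ge0. Qed.

Definition increments (m : nat) (s : R) (w : T) : seq_space :=
  fun i => L (s + dyadic m i.+1) w - L (s + dyadic m i) w.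

Lemma measurable_increments m s : measurable_fun setT (increments m s).
Proof. by apply: measurable_seq_spaceP => k; apply: measurable_funB; exact: measurable_funPT. Qed.

(** Independence along the times 0, s, s + h, s + 2h, and so on, where h is the
grid step.  The first increment is [L s] because [L] starts from 0, and the
next ones have the law of [L h] by stationarity.  The right-hand side depends
on [s] only through [L s], which is what makes the case [s = 0] comparable to
the others. *)
Lemma increments_independent m s (C : set R) (B : nat -> set R) n :
  0 <= s -> measurable C -> (forall i, measurable (B i)) ->
  P ([set w | C (L s w)] `&` [set w | forall i, (i < n)%N -> B i (increments m s w i)]) =
  (P [set w | C (L s w)] * \prod_(i < n) P [set w | B i (L (dyadic m 1) w)])%E.
Proof.
move=> s0 mC mB.
pose t i := if i is j.+1 then s + dyadic m j else 0.
have t0 i : 0 <= t i by case: i => //= i; rewrite addr_ge0// dyadic_ge0.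
have tnd : nondecreasing_seq t.
  apply/nondecreasing_seqP => -[|i] /=; first by rewrite addr_ge0// dyadic_ge0.
  by rewrite lerD2l dyadicS lerDl dyadic_ge0.
pose B' (i : 'I_n.+1) := if val i is j.+1 then B j else C.
have mB' i : measurable (B' i) by rewrite /B'; case: (val i).
have := levy_independent_increments hL t0 tnd (n := n.+1) (J := [set: 'I_n.+1]%SET)
   (fun i _ => mB' i).
rewrite (_ : \bigcap_(i in _) _ = [set w | C (L s w)] `&`
   [set w | forall i, (i < n)%N -> B i (increments m s w i)]); last first.
  apply/seteqP; split=> w /=.
    move=> H; split.
      have := H ord0 (finset.in_setT _).
      by rewrite /B' /= /t/= dyadic0 addr0 levy_start// subr0.
    move=> i ilt; have /= := H (@Ordinal n.+1 i.+1 ilt) (finset.in_setT _).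
    exact.
  move=> [wC wB] [[|i] ilt] _ /=; last exact: wB.
  by rewrite /B' /= /t/= dyadic0 addr0 levy_start// subr0.
move=> ->; rewrite (eq_bigl xpredT); last by move=> i; rewrite finset.in_setT.
rewrite big_ord_recl; congr (_ * _)%E.
  congr (P _); apply/seteqP; split=> w /=;
    by rewrite /B' /= /t/= dyadic0 addr0 (levy_start hL) subr0.
apply: eq_bigr => i _.
have := levy_stationary_increments hL (addr_ge0 s0 (dyadic_ge0 m i)) (dyadic_ge0 m 1) (mB i).
by rewrite -addrA -dyadicS.
Qed.

(** For a fixed event [C], both sides of the product rule are finite measures in
[A], so it extends from any class on which finite measures are determined. *)
Lemma product_rule_unique d' (Z : measurableType d') (G : set (set Z))
    (X Y : T -> Z) (C : set T) :
  measurable_fun setT X -> measurable_fun setT Y -> measurable C ->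
  (forall m1 m2 : {measure set Z -> \bar R}, (m1 setT < +oo)%E ->
    (forall A, G A -> m1 A = m2 A) -> forall A, measurable A -> m1 A = m2 A) ->
  (forall A, G A -> P (C `&` X @^-1` A) = P C * P (Y @^-1` A))%E ->
  forall A, measurable A -> P (C `&` X @^-1` A) = (P C * P (Y @^-1` A))%E.
Proof.
move=> mX mY mC uniq_G PG A mA.
have pC : P C = (fine (P C))%:E by rewrite fineK// fin_num_measure.
pose c : {nonneg R} := NngNum (fine_ge0 (measure_ge0 P C)).
pose m1 := image_measure (mrestr P mC) mX.
pose m2 := mscale c (image_measure P mY) : {measure set Z -> \bar R}.
have m1E B : m1 B = P (C `&` X @^-1` B) by rewrite setIC.
have m2E B : m2 B = (P C * P (Y @^-1` B))%E by rewrite [in RHS]pC.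
rewrite -m1E -m2E; apply: (uniq_G m1 m2) => // [|B GB]; last by rewrite m1E m2E PG.
rewrite m1E preimage_setT setIT; apply: (@le_lt_trans _ _ 1%E); last exact: ltry.
exact: probability_le1.
Qed.

Let measurable_levy s (C : set R) : measurable C -> measurable [set w | C (L s w)].
Proof. by move=> mC; rewrite -[X in measurable X]setTI; exact: measurable_funPT. Qed.

Lemma increments_law m s (C : set R) (A : set seq_space) :
  0 <= s -> measurable C -> measurable A ->
  P ([set w | C (L s w)] `&` increments m s @^-1` A) =
  (P [set w | C (L s w)] * P (increments m 0 @^-1` A))%E.
Proof.
move=> s0 mC; apply: (product_rule_unique (measurable_increments m s)
  (measurable_increments m 0) (measurable_levy _ mC) (@seq_measure_unique R)).
move=> _ [B [n [mB nB ->]]].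
have preE r : increments m r @^-1` [set a | forall i, B i (a i)] =
    [set w | forall i, (i < n)%N -> B i (increments m r w i)].
  apply/seteqP; split=> w /= H i; first by move=> _; exact: H.
  by have [/H//|/nB ->] := ltnP i n.
rewrite !preE increments_independent//; congr (_ * _)%E.
have := increments_independent m n (lexx 0) measurableT mB.
rewrite [X in P (X `&` _)](_ : _ = setT)// setTI => ->.
by rewrite [X in P X](_ : _ = setT)// probability_setT mul1e.
Qed.

Definition partial_sums (a : seq_space) : seq_space := fun k => \sum_(i < k) a i.

Lemma measurable_partial_sums : measurable_fun setT partial_sums.
Proof.
apply: measurable_seq_spaceP => k; apply: measurable_sum => i.
exact: measurable_seq_nth.
Qed.

Lemma increment_path_dyadic m s w :
  (fun k => increment_path s w (dyadic m k)) = partial_sums (increments m s w).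
Proof.
apply/funext => k; rewrite /partial_sums /increment_path /increments.
rewrite -(big_mkord xpredT (fun i => L (s + dyadic m i.+1) w - L (s + dyadic m i) w)).
by rewrite telescope_sumr// dyadic0 addr0.
Qed.

(** The Markov property in the form used below: the path of increments after
time [s] is independent of [L s] and distributed as [L] itself. *)
Lemma increment_path_law s (C : set R) (A : set path_space) :
  0 <= s -> measurable C -> measurable A ->
  P ([set w | C (L s w)] `&` increment_path s @^-1` A) =
  (P [set w | C (L s w)] * P (increment_path 0 @^-1` A))%E.
Proof.
move=> s0 mC; apply: (product_rule_unique (measurable_increment_path s)
  (measurable_increment_path 0) (measurable_levy _ mC) (@path_measure_unique R)).
move=> _ [m [S [mS ->]]].
have preE r : increment_path r @^-1` [set p | S (fun k => p (dyadic m k))] =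
    increments m r @^-1` (partial_sums @^-1` S).
  by apply/seteqP; split=> w /=; rewrite increment_path_dyadic.
rewrite !preE increments_law//.
by rewrite -[X in measurable X]setTI; exact: measurable_partial_sums.
Qed.

End levy_increments.

(** * The exponential moments are constant *)

Section exponential_moment.
Context {R : realType} {d : measure_display} {T : measurableType d}.
Variables (P : probability T R) (L : R -> {RV P >-> R}).
Hypothesis hL : is_levy_process L.
Local Notation path_space := (path_space R).
Local Notation dyadic := (@dyadic R).
Local Notation incr := (@increment_path R d T P L).

Definition increment_path_RV s : {mfun T >-> path_space} :=
  HB.pack (incr s) (isMeasurableFun.Build _ _ _ _ _ (measurable_increment_path L s)).

(** Independence as an integral formula: under the expectation, the future
increments may be replaced by those of an independent copy of [L]. *)
Lemma increment_path_fubini s (F : R * path_space -> \bar R) : 0 <= s ->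
  measurable_fun setT F -> (forall z, (0 <= F z)%E) ->
  (\int[P]_w F (L s w, incr s w) = \int[P]_w \int[P]_v F (L s w, incr 0%R v))%E.
Proof.
move=> s0 mF F0.
pose X0 := increment_path_RV 0.
pose pr w := (L s w, incr s w).
have mpr : measurable_fun setT pr.
  apply: measurable_fun_pair; first exact: measurable_funPT.
  exact: measurable_increment_path.
transitivity (\int[image_measure P mpr]_z F z)%E.
  by rewrite ge0_integral_pushforward//= preimage_setT.
transitivity (\int[(distribution P (L s) \x distribution P X0)%E]_z F z)%E.
  apply: eq_measure_integral => A mA _.
  apply/esym/(product_measure_unique (m' := image_measure P mpr)) => // B C mB mC.
  exact: increment_path_law.
rewrite fubini_tonelli1// ge0_integral_distribution//=.
- apply: eq_integral => w _; rewrite /fubini_F ge0_integral_distribution//.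
  by apply: measurableT_comp => //; exact: pair1_measurable.
- exact: measurable_fun_fubini_tonelli_F.
- by move=> y; apply: integral_ge0.
Qed.

Definition exp_moment (s : R) : \bar R := (\int[P]_w (expR (L s w))%:E)%E.

Lemma exp_moment_ge0 s : (0 <= exp_moment s)%E.
Proof. by apply: integral_ge0 => w _; rewrite lee_fin expR_ge0. Qed.

Lemma measurable_exp_levy s : measurable_fun setT (fun w => (expR (L s w))%:E).
Proof.
apply/measurable_EFinP; apply: measurableT_comp; first exact: measurable_expR.
exact: measurable_funPT.
Qed.

Lemma exp_momentD s t : 0 <= s -> 0 <= t ->
  exp_moment (s + t) = (exp_moment s * exp_moment t)%E.
Proof.
move=> s0 t0; have mexp := measurable_exp_levy.
pose F (z : R * path_space) := (expR z.1 * expR (path_value t z.2))%:E.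
have mF : measurable_fun setT F.
  apply/measurable_EFinP; apply: measurable_funM.
    by apply: measurableT_comp; [exact: measurable_expR|exact: measurable_fst].
  apply: measurableT_comp; first exact: measurable_expR.
  by apply: measurable_path_value; [exact: measurable_cst|exact: measurable_snd].
have F0 z : (0 <= F z)%E by rewrite lee_fin mulr_ge0// expR_ge0.
transitivity (\int[P]_w F (L s w, incr s w))%E.
  apply: eq_integral => w _; rewrite /F/= path_value_increment_path//.
  by rewrite -expRD addrCA subrr addr0.
rewrite increment_path_fubini//.
transitivity (\int[P]_w ((expR (L s w))%:E * exp_moment t))%E.
  apply: eq_integral => w _; rewrite -ge0_integralZl ?lee_fin ?expR_ge0//.
    by apply: eq_integral => v _; rewrite /F/= path_value_increment_path0// EFinM.
by rewrite ge0_integralZr// exp_moment_ge0.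
Qed.

Hypothesis L_exp : ('E_P[fun w => expR (L 1%R w)] = 1)%E.

Lemma exp_moment1 : exp_moment 1 = 1%E.
Proof. by rewrite -L_exp unlock. Qed.

Lemma exp_moment0 : exp_moment 0 = 1%E.
Proof.
rewrite /exp_moment; under eq_integral do rewrite (levy_start hL) expR0.
rewrite integral_cst// mul1e; exact: (probability_setT P).
Qed.

Lemma exp_moment_nat n : exp_moment n%:R = 1%E.
Proof.
elim: n => [|n IH]; first exact: exp_moment0.
by rewrite -natr1 exp_momentD// IH exp_moment1 mule1.
Qed.

(** By multiplicativity, the moment at [1 / 2 ^ m.+1] is a nonnegative square root
of the moment at [1 / 2 ^ m]. *)
Lemma exp_moment_dyadic1 m : exp_moment (dyadic m 1) = 1%E.
Proof.
elim: m => [|m IH]; first by rewrite /dyadic expr0 divr1 exp_moment1.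
have : (exp_moment (dyadic m.+1 1) * exp_moment (dyadic m.+1 1) = 1)%E.
  rewrite -exp_momentD ?dyadic_ge0// -IH; congr exp_moment.
  by rewrite /dyadic exprS; field; rewrite expf_neq0.
have := exp_moment_ge0 (dyadic m.+1 1); case: (exp_moment _) => [r|//|//].
rewrite lee_fin => r0; rewrite -EFinM => -[/eqP]; rewrite -expr2 sqrf_eq1.
by case/orP => /eqP rE; move: r0; rewrite rE ?oppr_ge0 ?ler10.
Qed.

Lemma exp_moment_dyadic m k : exp_moment (dyadic m k) = 1%E.
Proof.
elim: k => [|k IH]; first by rewrite dyadic0 exp_moment0.
by rewrite dyadicS exp_momentD ?dyadic_ge0// IH exp_moment_dyadic1 mule1.
Qed.

(** Fatou's lemma along dyadic times decreasing to [s], where the moment is 1. *)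
Lemma exp_moment_le1 s : 0 <= s -> (exp_moment s <= 1)%E.
Proof.
move=> s0; pose f m w := (expR (L (dyadic m (Num.truncn (2 ^+ m * s)).+1) w))%:E.
have cf w : f m w @[m --> \oo] --> (expR (L s w))%:E.
  have [rc _] := levy_cadlag hL w.
  have H := dyadic_above_cvg s0 (rc _ s0).
  apply: cvg_EFin; first exact: nearW.
  exact: (cvg_comp _ _ H (@continuous_expR R _)).
have := fatou P measurableT (f := f) (fun m => measurable_exp_levy _).
have f0 m w : setT w -> (0 <= f m w)%E by rewrite lee_fin expR_ge0.
move=> /(_ f0).
rewrite (eq_integral (fun w => (expR (L s w))%:E)); last first.
  move=> w _; rewrite is_cvg_limn_einfE; first exact/cvg_lim/cf.
  by apply/cvg_ex; eexists; exact: cf.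
move=> /le_trans; apply.
rewrite (_ : (fun n => _) = cst 1%E); last first.
  by apply/funext => n; exact: exp_moment_dyadic.
have c1 : (cst 1%E : nat -> \bar R) m @[m --> \oo] --> 1%E by exact: cvg_cst.
by rewrite is_cvg_limn_einfE; [rewrite (cvg_lim _ c1)|apply/cvg_ex; exists 1%E].
Qed.

(** For an integer [n >= s] the moments at [s] and [n - s] have product 1 and are
both at most 1. *)
Lemma exp_momentE s : 0 <= s -> exp_moment s = 1%E.
Proof.
move=> s0; apply/eqP; rewrite eq_le exp_moment_le1//=.
pose n := (Num.truncn s).+1.
have ns : 0 <= n%:R - s by rewrite subr_ge0 ltW// truncnS_gt.
rewrite -(exp_moment_nat n) (_ : n%:R = s + (n%:R - s)); last by rewrite addrC subrK.
rewrite exp_momentD// -[leRHS]mule1 lee_pmul ?exp_moment_ge0//.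
exact: exp_moment_le1.
Qed.

End exponential_moment.

(** * Stationarity under the exponential weight *)

Lemma measurable_expRN (R : realType) : measurable_fun setT (fun x : R => (expR (- x))%:E).
Proof.
apply/measurable_EFinP; apply: measurableT_comp; first exact: measurable_expR.
exact: oppr_measurable.
Qed.

Section stationarity.
Context {R : realType} {d : measure_display} {T : measurableType d}.
Variables (P : probability T R) (L : R -> {RV P >-> R}).
Hypothesis hL : is_levy_process L.
Hypothesis L_exp : ('E_P[fun w => expR (L 1%R w)] = 1)%E.
Local Notation mu := (@lebesgue_measure R).
Local Notation path_space := (path_space R).
Local Notation incr := (@increment_path R d T P L).

Definition exp_average (G : R * path_space -> \bar R) (p : path_space) : \bar R :=
  (\int[mu]_x ((expR (- x))%:E * G (x, p)))%E.

Lemma measurable_exp_average G : measurable_fun setT G -> (forall z, (0 <= G z)%E) ->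
  measurable_fun setT (exp_average G).
Proof.
move=> mG G0.
have mF : measurable_fun setT (fun z : R * path_space => (expR (- z.1))%:E * G z)%E.
  apply: emeasurable_funM => //.
  exact: (measurableT_comp (@measurable_expRN R) measurable_fst).
apply: (@measurable_fun_fubini_tonelli_G _ _ (measurableTypeR R) path_space R mu _ mF).
by move=> z; rewrite mule_ge0// lee_fin expR_ge0.
Qed.

Lemma exp_average_ge0 G p : (forall z, (0 <= G z)%E) -> (0 <= exp_average G p)%E.
Proof. by move=> G0; apply: integral_ge0 => x _; rewrite mule_ge0// lee_fin expR_ge0. Qed.

(** Translation invariance of Lebesgue measure: shifting by [c] multiplies the
density [exp (- x)] by [exp c]. *)
Lemma exp_average_shift G c p : measurable_fun setT G -> (forall z, (0 <= G z)%E) ->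
  (\int[mu]_x ((expR (- x))%:E * G ((x + c)%R, p)))%E = ((expR c)%:E * exp_average G p)%E.
Proof.
move=> mG G0.
have mGp : measurable_fun setT (fun x : R => G (x, p)).
  by apply: measurableT_comp => //; exact: pair2_measurable.
have mE : measurable_fun setT (fun x : R => ((expR (- x))%:E * G (x, p))%E).
  by apply: emeasurable_funM => //; exact: measurable_expRN.
rewrite /exp_average -ge0_integralZl//; last first.
  by move=> x _; rewrite mule_ge0// lee_fin expR_ge0.
rewrite [RHS](integral_shift c)//; last 2 first.
- exact: measurable_funeM.
- by move=> x; rewrite !mule_ge0// lee_fin expR_ge0.
apply: eq_integral => x _; rewrite muleA -EFinM -expRD; congr ((expR _)%:E * _)%E.
by rewrite opprD addrCA subrr addr0.
Qed.

(** After the shift by [L s], the factor [exp (L s)] is independent of the future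
increments and has mean 1. *)
Lemma stationary s G : 0 <= s -> measurable_fun setT G -> (forall z, (0 <= G z)%E) ->
  (\int[P]_w \int[mu]_x ((expR (- x))%:E * G ((x + L s w)%R, incr s w)) =
   \int[P]_w exp_average G (incr 0%R w))%E.
Proof.
move=> s0 mG G0; pose F (z : R * path_space) := ((expR z.1)%:E * exp_average G z.2)%E.
have mH := measurable_exp_average mG G0.
have mF : measurable_fun setT F.
  apply: emeasurable_funM; last exact: measurableT_comp.
  apply/measurable_EFinP.
  by apply: measurableT_comp; [exact: measurable_expR|exact: measurable_fst].
have F0 z : (0 <= F z)%E by rewrite mule_ge0 ?lee_fin ?expR_ge0// exp_average_ge0.
transitivity (\int[P]_w F (L s w, incr s w))%E.
  by apply: eq_integral => w _; rewrite exp_average_shift.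
rewrite increment_path_fubini// /F/=.
set K := (\int[P]_w exp_average G (incr 0 w))%E.
have mHi : measurable_fun setT (fun w => exp_average G (incr 0 w)).
  by apply: measurableT_comp => //; exact: measurable_increment_path.
transitivity (\int[P]_w ((expR (L s w))%:E * K))%E.
  apply: eq_integral => w _; rewrite ge0_integralZl// ?lee_fin ?expR_ge0//.
  by move=> v _; exact: exp_average_ge0.
rewrite ge0_integralZr//; last 2 first.
- exact: measurable_exp_levy.
- by apply: integral_ge0 => w _; exact: exp_average_ge0.
by rewrite -/(exp_moment L s) (exp_momentE hL L_exp)// mul1e.
Qed.

(** Integrating the previous identity over the times [s] in [D] and exchanging
the three integrals: the time integral along each path comes innermost, where
it can be computed path by path. *)
Lemma average_stationary (D : set R) G : measurable D -> (forall s, D s -> 0 <= s) ->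
  measurable_fun setT G -> (forall z, (0 <= G z)%E) ->
  (\int[P]_w \int[mu]_x ((expR (- x))%:E *
      \int[mu]_(s in D) G ((x + L s w)%R, incr s w)) =
   mu D * \int[P]_w exp_average G (incr 0%R w))%E.
Proof.
move=> mD D0 mG G0.
(* [L] is unconstrained at negative times; [pos] avoids them *)
pose pos (s : R) := Num.max 0 s.
have pos0 s : 0 <= pos s by rewrite /pos le_max lexx.
have posD s : D s -> pos s = s by move=> /D0 s0; rewrite /pos max_r.
have mpos : measurable_fun setT pos by apply: measurable_maxr.
have mL : measurable_fun setT (fun sw : R * T => L (pos sw.1) sw.2).
  rewrite (_ : (fun _ => _) = (fun sw : R * T => path_value (pos sw.1) (incr 0 sw.2))).
    apply: measurable_path_value.
      exact: (measurableT_comp mpos measurable_fst).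
    exact: (measurableT_comp (measurable_increment_path L 0) measurable_snd).
  by apply/funext => sw; rewrite path_value_increment_path0.
have mi : measurable_fun setT (fun sw : R * T => incr (pos sw.1) sw.2).
  apply: measurable_path_spaceP => m k; apply: measurable_funB => //.
  rewrite (_ : (fun _ => _) = (fun sw : R * T =>
      path_value (pos sw.1 + dyadic R m k) (incr 0 sw.2))); last first.
    by apply/funext => sw; rewrite path_value_increment_path0// addr_ge0// dyadic_ge0.
  apply: measurable_path_value.
    by apply: measurable_funD => //; exact: (measurableT_comp mpos measurable_fst).
  exact: (measurableT_comp (measurable_increment_path L 0) measurable_snd).
pose K (z : (R * T) * R) : \bar R := ((\1_D z.1.1)%:E * ((expR (- z.2))%:E *
   G ((z.2 + L (pos z.1.1) z.1.2)%R, incr (pos z.1.1) z.1.2)))%E.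
have K0 z : (0 <= K z)%E by rewrite /K !mule_ge0// lee_fin ?expR_ge0.
have mK : measurable_fun setT K.
  apply: emeasurable_funM.
    apply/measurable_EFinP.
    apply: (measurableT_comp (measurable_indic mD)).
    exact: (measurableT_comp measurable_fst measurable_fst).
  apply: emeasurable_funM.
    exact: (measurableT_comp (@measurable_expRN R) measurable_snd).
  apply: (measurableT_comp mG (g := fun z : (R * T) * R =>
     (z.2 + L (pos z.1.1) z.1.2, incr (pos z.1.1) z.1.2))).
  apply: measurable_fun_pair.
    apply: measurable_funD; first exact: measurable_snd.
    exact: (measurableT_comp mL measurable_fst).
  exact: (measurableT_comp mi measurable_fst).
transitivity (\int[P]_w \int[mu]_x \int[mu]_s K (s, w, x))%E.
  apply: eq_integral => w _; apply: eq_integral => x _.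
  have mGs : measurable_fun D (fun s : R => G (x + L s w, incr s w)).
    apply: (eq_measurable_fun (fun s : R => G (x + L (pos s) w, incr (pos s) w))).
      by move=> s; rewrite inE => Ds; rewrite posD.
    apply: measurable_funTS; apply: (measurableT_comp mG
      (g := fun s : R => (x + L (pos s) w, incr (pos s) w))).
    apply: measurable_fun_pair.
      apply: measurable_funD; first exact: measurable_cst.
      exact: (measurableT_comp mL (pair2_measurable w)).
    exact: (measurableT_comp mi (pair2_measurable w)).
  rewrite -ge0_integralZl ?lee_fin ?expR_ge0//.
  rewrite [LHS]integral_mkcond; apply: eq_integral => s _.
  rewrite patchE /K/= indicE; case: ifPn => sD; last by rewrite mul0e.
  by rewrite mul1e posD//; rewrite inE in sD.
transitivity (\int[P]_w \int[mu]_s \int[mu]_x K (s, w, x))%E.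
  apply: eq_integral => w _.
  have mKw : measurable_fun setT
      (fun xs : measurableTypeR R * measurableTypeR R => K (xs.2, w, xs.1)).
    apply: (measurableT_comp mK (g := fun xs : R * R => (xs.2, w, xs.1))).
    apply: measurable_fun_pair; last exact: measurable_fst.
    by apply: measurable_fun_pair; [exact: measurable_snd|exact: measurable_cst].
  by rewrite (fubini_tonelli (m1 := mu) (m2 := mu)
     (fun xs : measurableTypeR R * measurableTypeR R => K (xs.2, w, xs.1))).
have mKx : measurable_fun setT (fun sw : R * T => \int[mu]_x K (sw, x))%E.
  exact: (@measurable_fun_fubini_tonelli_F _ _ (R * T)%type (measurableTypeR R) R mu K mK K0).
transitivity (\int[mu]_s \int[P]_w \int[mu]_x K (s, w, x))%E.
  have mKws : measurable_fun setT
      (fun ws : T * measurableTypeR R => \int[mu]_x K (ws.2, ws.1, x))%E.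
    apply: (measurableT_comp mKx (g := fun ws : T * R => (ws.2, ws.1))).
    by apply: measurable_fun_pair; [exact: measurable_snd|exact: measurable_fst].
  rewrite (fubini_tonelli (m1 := P) (m2 := mu)
     (fun ws : T * measurableTypeR R => \int[mu]_x K (ws.2, ws.1, x))%E)//.
  by move=> ws; apply: integral_ge0.
set I := (\int[P]_w exp_average G (incr 0 w))%E.
transitivity (\int[mu]_(s in D) I)%E; last by rewrite integral_cst// muleC.
rewrite [RHS]integral_mkcond; apply: eq_integral => s _.
rewrite patchE /K/= indicE; case: ifPn => sD.
  rewrite inE in sD; rewrite /I -(stationary (D0 _ sD) mG G0).
  apply: eq_integral => w _; apply: eq_integral => x _.
  by rewrite mul1e posD.
by apply: integral0_eq => w _; apply: integral0_eq => x _; rewrite mul0e.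
Qed.

Lemma average_le (D1 D2 : set R) G1 G2 : measurable D1 -> measurable D2 ->
  (forall s, D1 s -> 0 <= s) -> (forall s, D2 s -> 0 <= s) ->
  measurable_fun setT G1 -> measurable_fun setT G2 ->
  (forall z, (0 <= G1 z)%E) -> (forall z, (0 <= G2 z)%E) ->
  (forall x w, (\int[mu]_(s in D1) G1 ((x + L s w)%R, incr s w) <=
                \int[mu]_(s in D2) G2 ((x + L s w)%R, incr s w))%E) ->
  (mu D1 * \int[P]_w exp_average G1 (incr 0%R w) <=
   mu D2 * \int[P]_w exp_average G2 (incr 0%R w))%E.
Proof.
move=> mD1 mD2 D10 D20 mG1 mG2 G10 G20 G12.
rewrite -(average_stationary mD1 D10 mG1 G10) -(average_stationary mD2 D20 mG2 G20).
have int0 x w : (0 <= (expR (- x))%:E *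
    \int[mu]_(s in D1) G1 ((x + L s w)%R, incr s w))%E.
  by rewrite mule_ge0// ?lee_fin ?expR_ge0// integral_ge0.
apply: ge0_le_integral_pointwise => w; first exact: integral_ge0.
apply: ge0_le_integral_pointwise => x; first exact: int0.
by apply: lee_wpmul2l; first by rewrite lee_fin expR_ge0.
Qed.

End stationarity.

(** Divide by [S] and let [S] tend to infinity. *)
Lemma eq_of_asymptotic_bounds (R : realType) (C : R) (I J : \bar R) : 0 <= C ->
  (0 <= I)%E -> (0 <= J)%E ->
  (forall S : R, (0 <= S)%R -> S%:E * I <= (S + C)%R%:E * J)%E ->
  (forall S : R, (C <= S)%R -> (S - C)%R%:E * J <= S%:E * I)%E -> I = J.
Proof.
move=> C0 I0 J0 IJ JI.
case: I => [I||//] in I0 IJ JI *; case: J => [J||//] in J0 IJ JI *.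
- (* if, say, [J < I], take [S] slightly larger than [C * J / (I - J)] *)
  rewrite !lee_fin in I0 J0; congr _%:E; apply/eqP; rewrite eq_le; apply/andP; split.
    rewrite leNgt; apply/negP => JltI; have k0 : 0 < I - J by rewrite subr_gt0.
    have q0 : 0 <= C * J / (I - J) by rewrite !mulr_ge0// invr_ge0 ltW.
    have qE : C * J / (I - J) * (I - J) = C * J by rewrite divfK// gt_eqF.
    have := IJ (C * J / (I - J) + 1); rewrite -!EFinM !lee_fin addr_ge0// => /(_ isT).
    set q := C * J / (I - J) in q0 qE *; nra.
  rewrite leNgt; apply/negP => IltJ; have k0 : 0 < J - I by rewrite subr_gt0.
  have q0 : 0 <= C * J / (J - I) by rewrite !mulr_ge0// invr_ge0 ltW.
  have qE : C * J / (J - I) * (J - I) = C * J by rewrite divfK// gt_eqF.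
  have := JI (C * J / (J - I) + 1 + C); rewrite -!EFinM !lee_fin lerDr addr_ge0// => /(_ isT).
  set q := C * J / (J - I) in q0 qE *; nra.
- have := JI (C + 1); rewrite lerDl => /(_ ler01).
  by rewrite addrAC subrr add0r mul1e -EFinM leye_eq.
- have := IJ 1; rewrite ler01 => /(_ isT).
  by rewrite mul1e -EFinM leye_eq.
- by [].
Qed.

(** * The time-changed process *)

Section time_change.
Context {R : realType} {d : measure_display} {T : measurableType d}.
Variables (P : probability T R) (L : R -> {RV P >-> R}).
Hypothesis hL : is_levy_process L.
Hypothesis L_exp : ('E_P[fun w => expR (L 1%R w)] = 1)%E.
Variables (alpha : R -> R) (a M : R).
Hypothesis malpha : measurable_fun setT alpha.
Hypothesis a0 : 0 < a.
Hypothesis ab : forall z, a <= alpha z <= M.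
Local Notation mu := (@lebesgue_measure R).
Local Notation path_space := (path_space R).
Local Notation incr := (@increment_path R d T P L).

(** The clock and the time-changed position as functions of the starting point
and of the path, so that they can be evaluated at the path seen from any time
[s].  They read the path through [path_value] to be measurable. *)
Definition path_clock (t : R) (z : R * path_space) : R :=
  clock (fun r => alpha (path_value r z.2 + z.1)) t.

Definition time_changed_path (t : R) (z : R * path_space) : R :=
  path_value (path_clock t z) z.2 + z.1.

Lemma measurable_path_rate : measurable_fun setT
  (fun zr : (R * path_space) * R => alpha (path_value zr.2 zr.1.2 + zr.1.1)).
Proof.
apply: measurableT_comp => //; apply: measurable_funD.
  apply: measurable_path_value; first exact: measurable_snd.
  exact: (measurableT_comp measurable_snd measurable_fst).
exact: (measurableT_comp measurable_fst measurable_fst).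
Qed.

Lemma measurable_path_clock t : 0 <= t -> measurable_fun setT (path_clock t).
Proof.
move=> t0; exact: (@measurable_clock R _ (R * path_space)%type
  (fun zr => alpha (path_value zr.2 zr.1.2 + zr.1.1)) a M t measurable_path_rate a0
  (fun z => ab _) t0).
Qed.

Lemma measurable_time_changed_path t : 0 <= t ->
  measurable_fun setT (time_changed_path t).
Proof.
move=> t0; apply: measurable_funD; last exact: measurable_fst.
by apply: measurable_path_value; [exact: measurable_path_clock|exact: measurable_snd].
Qed.

(** The trajectory [L r + x], written so that it is measurable in [r]. *)
Definition trajectory (x : R) (w : T) (r : R) : R := path_value r (incr 0 w) + x.

Lemma measurable_trajectory x w : measurable_fun setT (trajectory x w).
Proof.
apply: measurable_funD; last exact: measurable_cst.
by apply: measurable_path_value; [exact: measurable_id|exact: measurable_cst].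
Qed.

Lemma measurable_trajectory_preimage x w (A : set R) : measurable A ->
  measurable (trajectory x w @^-1` A).
Proof.
by move=> mA; rewrite -[X in measurable X]setTI; exact: measurable_trajectory.
Qed.

Let mh x w : measurable_fun setT (alpha \o trajectory x w).
Proof. by apply: measurableT_comp => //; exact: measurable_trajectory. Qed.

Lemma trajectoryE x w r : 0 <= r -> trajectory x w r = L r w + x.
Proof. by move=> r0; rewrite /trajectory path_value_increment_path0. Qed.

(** The path restarted at time [s] from its current position follows the
original trajectory; hence so does its time-changed version below. *)
Lemma trajectory_shift x w s r : 0 <= s -> 0 <= r ->
  path_value r (incr s w) + (x + L s w) = trajectory x w (s + r).
Proof.
move=> s0 r0; rewrite path_value_increment_path// trajectoryE ?addr_ge0//; ring.
Qed.

Lemma path_clock_shift t x w s : 0 <= s ->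
  path_clock t (x + L s w, incr s w) = clock (fun r => alpha (trajectory x w (s + r))) t.
Proof. by move=> s0; apply: clock_eq => r r0 /=; rewrite trajectory_shift. Qed.

Lemma time_changed_path_shift t x w s : 0 <= t -> 0 <= s ->
  time_changed_path t (x + L s w, incr s w) =
  trajectory x w (shifted_clock (alpha \o trajectory x w) t s).
Proof.
move=> t0 s0; rewrite /time_changed_path path_clock_shift//= trajectory_shift//.
have mhs : measurable_fun setT (fun r => alpha (trajectory x w (s + r))).
  apply: (measurableT_comp (mh x w) (g := fun r => s + r)); exact: measurable_funD.
exact: (clock_ge0 mhs a0 (fun r => ab _)).
Qed.

Lemma time_changedE t x w : 0 <= t ->
  time_changed alpha L t x w = time_changed_path t (x, incr 0 w).
Proof.
move=> t0; have cE : random_clock alpha L x t w = path_clock t (x, incr 0 w).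
  rewrite /path_clock /clock /random_clock; congr inf; apply/seteqP.
  suff H s : \int[mu]_(r in `[0, s]) alpha (L r w + x) =
      primitive (fun r => alpha (path_value r (incr 0 w) + x)) s.
    by split=> s /= [s0 ts]; split=> //; [rewrite -H|rewrite H].
  apply: eq_Rintegral => r; rewrite inE/= in_itv/= => /andP[r0 _].
  by rewrite path_value_increment_path0.
rewrite /time_changed cE /time_changed_path path_value_increment_path0//.
exact: (clock_ge0 (mh x w) a0 (fun r => ab _)).
Qed.

Variables (B : set R) (t : R).
Hypothesis mB : measurable B.
Hypothesis t0 : 0 <= t.

(** Averaged with [exp_average], [moved] gives the mass of [B] after time [t] and
[unmoved] the initial mass of [B]. *)
Definition moved (z : R * path_space) : \bar R :=
  (alpha z.1 * \1_B (time_changed_path t z))%:E.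

Definition unmoved (z : R * path_space) : \bar R := (alpha z.1 * \1_B z.1)%:E.

Let alpha0 z : 0 <= alpha z.
Proof. by have /andP[/(le_trans (ltW a0))] := ab z. Qed.

Let moved_ge0 z : (0 <= moved z)%E. Proof. by rewrite lee_fin mulr_ge0. Qed.
Let unmoved_ge0 z : (0 <= unmoved z)%E. Proof. by rewrite lee_fin mulr_ge0. Qed.

Let measurable_moved : measurable_fun setT moved.
Proof.
apply/measurable_EFinP; apply: measurable_funM.
  exact: (measurableT_comp malpha measurable_fst).
exact: (measurableT_comp (measurable_indic mB) (measurable_time_changed_path t0)).
Qed.

Let measurable_unmoved : measurable_fun setT unmoved.
Proof.
apply/measurable_EFinP; apply: measurable_funM.
  exact: (measurableT_comp malpha measurable_fst).
exact: (measurableT_comp (measurable_indic mB) measurable_fst).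
Qed.

Lemma integral_unmoved (D : set R) x w : measurable D -> (forall s, D s -> 0 <= s) ->
  (\int[mu]_(s in D) unmoved ((x + L s w)%R, incr s w))%E =
  density (alpha \o trajectory x w) (D `&` trajectory x w @^-1` B).
Proof.
move=> mD D0; rewrite -density_indic//; last exact: measurable_trajectory_preimage.
apply: eq_integral => s; rewrite inE => /D0 s0.
by rewrite /unmoved/= [x + _]addrC -trajectoryE// !indicE !inE.
Qed.

Lemma integral_moved (D : set R) x w : measurable D -> (forall s, D s -> 0 <= s) ->
  (\int[mu]_(s in D) moved ((x + L s w)%R, incr s w))%E =
  density (alpha \o trajectory x w)
   (D `&` shifted_clock (alpha \o trajectory x w) t @^-1` (trajectory x w @^-1` B)).
Proof.
move=> mD D0; rewrite -density_indic//; last first.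
  rewrite -[X in measurable X]setTI.
  apply: (measurable_shifted_clock (mh x w) a0 (fun r => ab _) t0) => //.
  exact: measurable_trajectory_preimage.
apply: eq_integral => s; rewrite inE => /D0 s0.
by rewrite /moved time_changed_path_shift//= [x + _]addrC -trajectoryE// !indicE !inE.
Qed.

Let I := (\int[P]_w exp_average moved (incr 0 w))%E.
Let J := (\int[P]_w exp_average unmoved (incr 0 w))%E.

Let tauP x w := density_tau_bounds (mh x w) a0 (fun r => ab _) t0
  (fun s => @shifted_clock_ge0 R _ a M t (mh x w) a0 (fun r => ab _) t0 s)
  (fun s => @primitive_shifted_clock R _ a M t (mh x w) a0 (fun r => ab _) t0 s).

Let itv_ge0 (u v s : R) : 0 <= u -> `[u, v]%classic s -> 0 <= s.
Proof. by move=> u0; rewrite /= in_itv/= => /andP[us _]; exact: le_trans us. Qed.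

Lemma moved_le_unmoved (S : R) : 0 <= S -> (S%:E * I <= (S + t / a)%:E * J)%E.
Proof.
move=> S0; have C0 : 0 <= t / a by rewrite divr_ge0// ltW.
have SC0 : 0 <= S + t / a by rewrite addr_ge0.
have <- : mu `[0, S] = S%:E by rewrite lebesgue_measure_segment// subr0.
have <- : mu `[0, S + t / a] = (S + t / a)%:E by rewrite lebesgue_measure_segment// subr0.
apply: (average_le hL L_exp (@measurable_itv R `[0, S])
  (@measurable_itv R `[0, S + t / a]) (fun s => @itv_ge0 0 S s (lexx 0))
  (fun s => @itv_ge0 0 _ s (lexx 0)) measurable_moved measurable_unmoved) => // x w.
rewrite (integral_moved x w (@measurable_itv R `[0, S]) (fun s => @itv_ge0 0 S s (lexx 0))).
rewrite (integral_unmoved x w (@measurable_itv R `[0, S + t / a])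
  (fun s => @itv_ge0 0 _ s (lexx 0))).
by have /andP[_] := tauP x w S0 (measurable_trajectory_preimage x w mB).
Qed.

Lemma unmoved_le_moved (S : R) : t / a <= S -> ((S - t / a)%:E * J <= S%:E * I)%E.
Proof.
move=> CS; have C0 : 0 <= t / a by rewrite divr_ge0// ltW.
have S0 := le_trans C0 CS.
have <- : mu `[0, S] = S%:E by rewrite lebesgue_measure_segment// subr0.
have <- : mu `[t / a, S] = (S - t / a)%:E by rewrite lebesgue_measure_segment.
apply: (average_le hL L_exp (@measurable_itv R `[t / a, S])
  (@measurable_itv R `[0, S]) (fun s => @itv_ge0 _ S s C0)
  (fun s => @itv_ge0 0 S s (lexx 0)) measurable_unmoved measurable_moved) => // x w.
rewrite (integral_unmoved x w (@measurable_itv R `[t / a, S]) (fun s => @itv_ge0 _ S s C0)).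
rewrite (integral_moved x w (@measurable_itv R `[0, S]) (fun s => @itv_ge0 0 S s (lexx 0))).
by have /andP[+ _] := tauP x w S0 (measurable_trajectory_preimage x w mB).
Qed.

Lemma moved_eq_unmoved : I = J.
Proof.
apply: (@eq_of_asymptotic_bounds R (t / a)).
- by rewrite divr_ge0// ltW.
- by apply: integral_ge0 => w _; exact: exp_average_ge0.
- by apply: integral_ge0 => w _; exact: exp_average_ge0.
- exact: moved_le_unmoved.
- exact: unmoved_le_moved.
Qed.

Lemma movedE : (\int[mu]_x (P [set w | B (time_changed alpha L t x w)] *
   (alpha x * expR (- x))%:E) = I)%E.
Proof.
rewrite /I /exp_average.
have mX : measurable_fun setT (fun wx : T * R => moved (wx.2, incr 0 wx.1)).
  apply: (measurableT_comp measurable_moved (g := fun wx : T * R => (wx.2, incr 0 wx.1))).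
  apply: measurable_fun_pair; first exact: measurable_snd.
  exact: (measurableT_comp (measurable_increment_path L 0) measurable_fst).
have mK : measurable_fun setT
    (fun wx : T * measurableTypeR R => ((expR (- wx.2))%:E * moved (wx.2, incr 0 wx.1))%E).
  apply: emeasurable_funM => //.
  exact: (measurableT_comp (@measurable_expRN R) measurable_snd).
rewrite (fubini_tonelli (m1 := P) (m2 := mu)
  (fun wx : T * measurableTypeR R =>
    (expR (- wx.2))%:E * moved (wx.2, incr 0 wx.1))%E)//; last first.
  by move=> wx; rewrite mule_ge0// lee_fin expR_ge0.
apply: eq_integral => x _.
have mA : measurable [set w | B (time_changed alpha L t x w)].
  rewrite (_ : [set w | _] = (fun w => time_changed_path t (x, incr 0 w)) @^-1` B); last first.
    by apply/seteqP; split=> w /=; rewrite time_changedE.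
  rewrite -[X in measurable X]setTI.
  apply: (measurableT_comp (measurable_time_changed_path t0) (g := fun w => (x, incr 0 w))) => //.
  by apply: measurable_fun_pair => //; exact: measurable_increment_path.
rewrite -[X in (P X * _)%E]setIT -integral_indic// muleC -ge0_integralZl//; last 2 first.
- by apply/measurable_EFinP; exact: measurable_indic.
- by rewrite lee_fin mulr_ge0// expR_ge0.
apply: eq_integral => w _; rewrite /moved/= -EFinM -EFinM; congr _%:E.
rewrite mulrA [expR _ * _]mulrC; congr (_ * _).
by rewrite -time_changedE// !indicE; congr (_%:R); apply/idP/idP; rewrite !inE.
Qed.

Lemma unmovedE : J = (\int[mu]_(x in B) (alpha x * expR (- x))%:E)%E.
Proof.
rewrite /J; under eq_integral.
  move=> w _; rewrite (_ : exp_average unmoved (incr 0 w) =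
    (\int[mu]_(x in B) (alpha x * expR (- x))%:E)%E); last first.
    rewrite /exp_average [RHS]integral_mkcond; apply: eq_integral => x _.
    rewrite /unmoved patchE /= -EFinM indicE; case: ifPn => xB.
      by rewrite mulr1 mulrC.
    by rewrite mulr0 mulr0.
  over.
rewrite integral_cst// -[RHS]mule1; congr (_ * _)%E; exact: (probability_setT P).
Qed.

End time_change.

Theorem theorem3p7 (R : realType) (d : measure_display) (T : measurableType d)
    (P : probability T R) (alpha : R -> R) (L : R -> {RV P >-> R})
    (alpha_gt0 : forall z, 0 < alpha z)
    (alpha_continuous : continuous alpha)
    (alpha_inf : (0 < ereal_inf (range (EFin \o alpha)))%E)
    (alpha_sup : (ereal_sup (range (EFin \o alpha)) < +oo)%E)
    (alpha_lim : alpha z @[z --> +oo] --> (1 : R))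
    (L_levy : is_levy_process L)
    (L_exp : ('E_P[fun w => expR (L 1%R w)] = 1)%E) :
  forall (B : set R) (t : R), measurable B -> 0 <= t ->
  (\int[lebesgue_measure]_x
      (P [set w | B (time_changed alpha L t x w)] *
       (alpha x * expR (- x))%:E) =
   \int[lebesgue_measure]_(x in B) (alpha x * expR (- x))%:E)%E.
Proof.
move=> B t mB t0.
have malpha : measurable_fun setT alpha by exact: continuous_measurable_fun.
have inf_le z : (ereal_inf (range (EFin \o alpha)) <= (alpha z)%:E)%E.
  by apply: ereal_inf_lbound; exists z.
have sup_ge z : ((alpha z)%:E <= ereal_sup (range (EFin \o alpha)))%E.
  by apply: ereal_sup_ubound; exists z.
have [a a0 aP] : exists2 a : R, 0 < a & forall z, a <= alpha z.
  case: (ereal_inf _) alpha_inf inf_le => [a|_ H|//].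
    by rewrite lte_fin => a0 H; exists a => // z; rewrite -lee_fin.
  by have := H 0.
have [M MP] : exists M : R, forall z, alpha z <= M.
  case: (ereal_sup _) alpha_sup sup_ge => [M _ H|//|_ H].
    by exists M => z; rewrite -lee_fin.
  by have := H 0.
have ab z : a <= alpha z <= M by rewrite aP MP.
rewrite (movedE L_levy malpha a0 ab mB t0).
by rewrite (moved_eq_unmoved L_levy L_exp malpha a0 ab mB t0) unmovedE.
Qed.
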